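(* Let $A\subset C$ be a ring extension of finite exponent, put $C^{[1]}:=A[C^p]$, and assume that $C$ has a $p$-basis $x_1,\ldots,x_n$ over $C^{[1]}$. Let $M$ be a $C$-module. For each $A$-linear map $\partial\colon C^{[1]}\to M$, define an $A$-linear map $D\colon C\to M$ by the formula $$D\Big(\sum_\alpha\lambda_\alpha \mathbf{x}^\alpha\Big)=\sum_\alpha \mathbf{x}^\alpha\,\partial(\lambda_\alpha),$$ where $\lambda_\alpha\in C^{[1]}$ and the sum is taken over the reduced monomials $\mathbf{x}^{\alpha}:=x_1^{\alpha_1}\cdots x_n^{\alpha_n}$ with $0\leq \alpha_i<p$. Then the assignment $\partial\mapsto D$ gives a morphism of left $C$-modules $$\mathrm{ext}\colon \mathrm{Hom}_A(C^{[1]},M)\to \mathrm{Hom}_A(C,M)$$ such that $\mathrm{res}\circ\mathrm{ext}=\mathrm{Id}$, where $\mathrm{res}\colon \mathrm{Hom}_A(C,M)\to \mathrm{Hom}_A(C^{[1]},M)$ is the restriction map $E\mapsto E|_{C^{[1]}}$; and for each $k\geq 0$ this map induces a map $$\mathrm{ext}\colon \mathrm{Diff}_A^{k}(C^{[1]},M)\to \mathrm{Diff}_A^{pk}(C,M).$$ In other words, if $\partial$ is a differential operator of order $\leq k$, then $D$ is a differential operator of order $\leq pk$.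
   Context: All rings are commutative with identity $1\neq 0$ and of characteristic $p$, for a fixed prime $p$. A ring extension $A\subset C$ has finite exponent if there is an integer $e\ge 0$ with $x^{p^e}\in A$ for all $x\in C$. $A[C^p]$ is the $A$-subalgebra of $C$ generated by all $x^p$, $x\in C$. $p$-basis: if $R\subset C$ is a ring extension with $x^p\in R$ for all $x\in C$, then $x_1,\ldots,x_n\in C$ form a $p$-basis for $C$ over $R$ if $C$ is a free $R$-module with basis the reduced monomials $x_1^{\alpha_1}\cdots x_n^{\alpha_n}$, $0\le\alpha_i<p$. For an $A$-algebra $S$ and an $S$-module $M$, $\mathrm{Hom}_A(S,M)$ is the set of $A$-linear maps. For $x\in S$ and $D\in\mathrm{Hom}_A(S,M)$ put $[x,D](s):=xD(s)-D(xs)$. $D$ is an $A$-differential operator of order $\le k$ if $[x_0,[x_1,[\ldots,[x_k,D]\ldots]]]=0$ for all $x_0,\ldots,x_k\in S$; the set of these is $\mathrm{Diff}_A^k(S,M)$. A $C$-module $M$ is regarded as a $C^{[1]}$-module by restriction of scalars. $\mathrm{Hom}_A(C,M)$ and $\mathrm{Hom}_A(C^{[1]},M)$ are left $C$-modules via $(c\cdot\varphi)(x)=c\,\varphi(x)$. *)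

(* Defs.v *)
From HB Require Import structures.
From mathcomp Require Import all_boot all_order all_algebra.
From mathcomp Require Import boolp.

Set Implicit Arguments.
Unset Strict Implicit.
Unset Printing Implicit Defensive.

Import GRing.Theory.
Local Open Scope ring_scope.

(* A ring extension R <= S is an injective ring morphism f : R -> S.  In
   particular a ring extension A <= C is a comAlgType A, called C, whose
   structure map [in_alg C], a |-> a%:A, is injective. *)
Definition finite_exponent (R S : comNzRingType) (f : {rmorphism R -> S})
    (p : nat) : Prop :=
  exists e : nat, forall x : S, exists r : R, x ^+ (p ^ e) = f r.

Section FrobeniusSubalgebra.
Variables (A : comNzRingType) (p : nat) (C : comAlgType A).

(* Membership in A[C^p], the smallest A-subalgebra of C containing every p-th
   power. *)
Definition frob_pred : {pred C} :=
  [pred c | `[< forall S : {pred C},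
      subalg_closed S -> (forall y : C, y ^+ p \in S) -> c \in S >]].

Lemma frob_pred_subalg : subalg_closed frob_pred.
Proof.
split.
- by apply/asboolP => S [].
- move=> a u v /asboolP Hu /asboolP Hv; apply/asboolP => S HS HpS.
  by case: (HS) => _ lS _; apply: lS; [apply: Hu | apply: Hv].
- move=> u v /asboolP Hu /asboolP Hv; apply/asboolP => S HS HpS.
  by case: (HS) => _ _ mS; apply: mS; [apply: Hu | apply: Hv].
Qed.

HB.instance Definition _ :=
  GRing.isSubalgClosed.Build A C frob_pred
    (GRing.subalg_closed_semi frob_pred_subalg).

Definition frob_alg := {c : C | c \in frob_pred}.

HB.instance Definition _ := SubChoice.on frob_alg.
HB.instance Definition _ := [SubChoice_isSubAlgebra of frob_alg by <:].
HB.instance Definition _ := [SubNzRing_isSubComNzRing of frob_alg by <:].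

End FrobeniusSubalgebra.

(* An alias of M itself, so that a map into M can be reread as a map into the
   R-module obtained from M by restriction of scalars along f. *)
Definition restr_scalars (R S : nzRingType) (f : {rmorphism R -> S})
  (M : lmodType S) : Type := M.

Section RestrictionOfScalars.
Variables (R S : nzRingType) (f : {rmorphism R -> S}) (M : lmodType S).
Local Notation fM := (restr_scalars f M).

HB.instance Definition _ := GRing.Zmodule.on fM.

Definition restr_scale (r : R) (m : fM) : fM := (f r *: (m : M) : M).

Fact restr_scaleA a b v :
  restr_scale a (restr_scale b v) = restr_scale (a * b) v.
Proof. by rewrite /restr_scale scalerA rmorphM. Qed.
Fact restr_scale1 : left_id 1 restr_scale.
Proof. by move=> v; rewrite /restr_scale rmorph1 scale1r. Qed.
Fact restr_scaleDr : right_distributive restr_scale +%R.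
Proof. by move=> a u v; exact: (@scalerDr S M). Qed.
Fact restr_scaleDl v : {morph restr_scale^~ v : a b / a + b}.
Proof. by move=> a b; rewrite /restr_scale rmorphD scalerDl. Qed.

HB.instance Definition _ := GRing.Zmodule_isLmodule.Build R fM
  restr_scaleA restr_scale1 restr_scaleDr restr_scaleDl.

End RestrictionOfScalars.

Definition is_basis (R : nzRingType) (V : lmodType R) (I : finType)
    (b : I -> V) : Prop :=
  (forall v : V, exists c : I -> R, v = \sum_i c i *: b i) /\
  (forall c : I -> R, \sum_i c i *: b i = 0 -> forall i, c i = 0).

(* A reduced monomial is given by its exponents, a function 'I_n -> 'I_p. *)
Definition rmon (S : comNzRingType) (p n : nat) (x : n.-tuple S)
    (a : {ffun 'I_n -> 'I_p}) : S :=
  \prod_(i < n) tnth x i ^+ a i.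

Definition p_basis (R S : comNzRingType) (f : {rmorphism R -> S}) (p n : nat)
    (x : n.-tuple S) : Prop :=
  [/\ injective f,
      forall y : S, exists r : R, y ^+ p = f r
    & is_basis (rmon (p := p) x : _ -> restr_scalars f S^o)].

(* Hom_A(V, M) for an A-module V and a C-module M, where M is an A-module
   through A -> C. *)
Definition linHom (A : comNzRingType) (C : comAlgType A) (V : lmodType A)
    (M : lmodType C) : Type :=
  {linear V -> M | in_alg C \; *:%R}.

Section HomModule.
Variables (A : comNzRingType) (C : comAlgType A).
Variables (V : lmodType A) (M : lmodType C).
Local Notation H := (linHom V M).
Implicit Types (u v w : H) (c d : C).

HB.instance Definition _ := gen_eqMixin H.
HB.instance Definition _ := gen_choiceMixin H.

Lemma linHom_eqP u v : (u : V -> M) =1 v -> u = v.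
Proof.
case: u v => [f [[f1] [f2]]] [g [[g1] [g2]]] /= /funext fg.
by subst g; congr GRing.Linear.Pack; congr GRing.Linear.Class;
   [congr Algebra.isNmodMorphism.Axioms_ | congr GRing.isScalable.Axioms_];
   apply: Prop_irrelevance.
Qed.

Definition linHom_of (f : V -> M) (lf : linear_for (in_alg C \; *:%R) f) : H :=
  HB.pack f (GRing.isLinear.Build A V M (in_alg C \; *:%R) f lf).

Fact linHom0_subproof : linear_for (in_alg C \; *:%R) (fun _ : V => 0 : M).
Proof. by move=> a x y /=; rewrite scaler0 addr0. Qed.
Fact linHomN_subproof u : linear_for (in_alg C \; *:%R) (fun x => - u x).
Proof. by move=> a x y /=; rewrite linearP /= opprD scalerN. Qed.
Fact linHomD_subproof u v : linear_for (in_alg C \; *:%R) (fun x => u x + v x).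
Proof. by move=> a x y /=; rewrite !linearP /= scalerDr addrACA. Qed.
Fact linHomZ_subproof c u : linear_for (in_alg C \; *:%R) (fun x => c *: u x).
Proof. by move=> a x y /=; rewrite linearP /= scalerDr !scalerA mulrC. Qed.

Definition linHom0 : H := linHom_of linHom0_subproof.
Definition linHomN u : H := linHom_of (linHomN_subproof u).
Definition linHomD u v : H := linHom_of (linHomD_subproof u v).
Definition linHomZ c u : H := linHom_of (linHomZ_subproof c u).

Fact linHomDA : associative linHomD.
Proof. by move=> u v w; apply: linHom_eqP => x /=; rewrite addrA. Qed.
Fact linHomDC : commutative linHomD.
Proof. by move=> u v; apply: linHom_eqP => x /=; rewrite addrC. Qed.
Fact linHom0D : left_id linHom0 linHomD.
Proof. by move=> u; apply: linHom_eqP => x /=; rewrite add0r. Qed.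
Fact linHomND : left_inverse linHom0 linHomN linHomD.
Proof. by move=> u; apply: linHom_eqP => x /=; rewrite addNr. Qed.

HB.instance Definition _ :=
  GRing.isZmodule.Build H linHomDA linHomDC linHom0D linHomND.

Fact linHomZA c d u : linHomZ c (linHomZ d u) = linHomZ (c * d) u.
Proof. by apply: linHom_eqP => x /=; rewrite scalerA. Qed.
Fact linHom1Z : left_id 1 linHomZ.
Proof. by move=> u; apply: linHom_eqP => x /=; rewrite scale1r. Qed.
Fact linHomZDr : right_distributive linHomZ +%R.
Proof. by move=> c u v; apply: linHom_eqP => x /=; rewrite scalerDr. Qed.
Fact linHomZDl u : {morph linHomZ^~ u : c d / c + d}.
Proof. by move=> c d; apply: linHom_eqP => x /=; rewrite scalerDl. Qed.

HB.instance Definition _ :=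
  GRing.Zmodule_isLmodule.Build C H linHomZA linHom1Z linHomZDr linHomZDl.

End HomModule.

Section Restriction.
Variables (A : comNzRingType) (p : nat) (C : comAlgType A) (M : lmodType C).

Fact linHom_res_subproof (E : linHom C M) :
  linear_for (in_alg C \; *:%R) (fun x : frob_alg p C => E (val x)).
Proof. by move=> a x y; rewrite !linearP. Qed.

Definition linHom_res (E : linHom C M) : linHom (frob_alg p C) M :=
  linHom_of (linHom_res_subproof E).

End Restriction.

Definition bracket (S : comNzRingType) (N : lmodType S) (x : S) (D : S -> N) :
    S -> N :=
  fun s => x *: D s - D (x * s).

(* Diff_A^k(S, N): the foldr is [x_0, [x_1, [..., [x_k, D]...]]]; the first conjunct is
   A-linearity, A acting on N through S. *)
Definition is_diff (A : comNzRingType) (S : comAlgType A) (N : lmodType S)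
    (k : nat) (D : S -> N) : Prop :=
  linear_for (in_alg S \; *:%R) D /\
  forall xs : k.+1.-tuple S, forall s : S,
    foldr (@bracket S N) D xs s = 0.

(* Main.v *)
(* Let D be the extension of d, and write [c, D] for the bracket.  For c in
   C^[1], [c, D] is the extension of [c, d].  Brackets by distinct x_i, i in B,
   turn D into the map l * x^a |-> w(a) * d_B(l), where d_B is the bracket of d
   by all the x_i^p, and w(a) is x^a with each factor x_i^(a_i), i in B,
   replaced by 1 if a_i = p - 1 and by 0 otherwise.  In characteristic p,
   bracketing p times by x_i is bracketing once by x_i^p.  Hence b_i brackets by each x_i
   bracket d at least sum_i ceil(b_i / p) times, so D is killed by more than p k
   of them, an element of C^[1] counting for p.  Maps with this vanishing
   property form a C-bimodule, so it suffices to test brackets on the algebra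
   generators x_i and C^[1] of C. *)
From HB Require Import structures.
Require Import Defs.
From mathcomp Require Import all_boot all_order all_algebra.
From mathcomp Require Import boolp.

Set Implicit Arguments.
Unset Strict Implicit.
Unset Printing Implicit Defensive.

Import GRing.Theory.
Local Open Scope ring_scope.

(** * Iterated brackets of maps from a ring to a module *)

Section Brackets.
Variables (S : comNzRingType) (N : lmodType S).
Implicit Types (D E : S -> N) (c s x y : S) (xs ys : seq S).

Local Notation "[[ xs , D ]]" := (foldr (@bracket S N) D xs) (at level 0).

Lemma bracketC x y D : bracket x (bracket y D) = bracket y (bracket x D).
Proof.
apply/funext => s; rewrite /bracket !scalerBr !scalerA (mulrC x y).
by rewrite (mulrCA x y) !opprB addrACA [RHS]addrACA [- _ + _ in RHS]addrC.
Qed.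

Lemma bracketD x y D : {morph D : s t / s + t} ->
  bracket (x + y) D = (fun s => bracket x D s + bracket y D s).
Proof.
move=> DD; apply/funext => s.
by rewrite /bracket scalerDl mulrDl DD opprD addrACA.
Qed.

(** The term [x *: D (y * s)] is inserted and cancelled. This form is what makes vanishing
    conditions on brackets pass to products. *)
Lemma bracketM x y D :
  bracket (x * y) D = (fun s => x *: bracket y D s + bracket x D (y * s)).
Proof.
by apply/funext => s; rewrite /bracket scalerBr scalerA mulrA addrA subrK.
Qed.

Lemma bracket_additive x D :
  {morph D : s t / s + t} -> {morph bracket x D : s t / s + t}.
Proof. by move=> DD s t; rewrite /bracket mulrDr !DD scalerDr opprD addrACA. Qed.

Lemma brackets_bracket xs x D : [[xs, bracket x D]] = bracket x [[xs, D]].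
Proof. by elim: xs => //= y xs ->; rewrite bracketC. Qed.

Lemma brackets_additive xs D :
  {morph D : s t / s + t} -> {morph [[xs, D]] : s t / s + t}.
Proof. by move=> DD; elim: xs => //= x xs; apply: bracket_additive. Qed.

Lemma brackets_perm xs ys D : perm_eq xs ys -> [[xs, D]] = [[ys, D]].
Proof.
move: xs ys; apply: (catCA_perm_subst (F := fun xs => [[xs, D]])) => s1 s2 s3.
rewrite !foldr_cat; elim: s1 => //= x s1 ->.
by rewrite brackets_bracket.
Qed.

Lemma brackets_add xs D E :
  [[xs, fun s => D s + E s]] = (fun s => [[xs, D]] s + [[xs, E]] s).
Proof.
elim: xs => //= x xs ->; apply/funext => s.
by rewrite /bracket scalerDr opprD addrACA.
Qed.

Lemma brackets_scale xs c D :
  [[xs, fun s => c *: D s]] = (fun s => c *: [[xs, D]] s).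
Proof.
elim: xs => //= x xs ->; apply/funext => s.
by rewrite /bracket scalerBr !scalerA mulrC.
Qed.

Lemma brackets_mul xs c D :
  [[xs, fun s => D (c * s)]] = (fun s => [[xs, D]] (c * s)).
Proof.
by elim: xs => //= x xs ->; apply/funext => s; rewrite /bracket mulrCA.
Qed.

Lemma brackets_eq0 xs D : (forall s, D s = 0) -> forall s, [[xs, D]] s = 0.
Proof.
move=> D0; elim: xs => //= x xs IH s.
by rewrite /bracket !IH scaler0 subrr.
Qed.

(* In characteristic p, (L_x - R_x)^p = L_x^p - R_x^p for the commuting
   operators L_x D = x D and R_x D = D (x _).  The polynomial P acts on D by
   letting 'X act as R_x. *)
Lemma brackets_pchar p x D :
  p \in [pchar S] -> [[nseq p x, D]] = bracket (x ^+ p) D.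
Proof.
move=> pS; have pP : p \in [pchar {poly S}] by rewrite (rmorph_pchar polyC pS).
pose Phi (P : {poly S}) s := \sum_(i < size P) P`_i *: D (x ^+ i * s).
have PhiE (P : {poly S}) m s : (size P <= m)%N ->
    Phi P s = \sum_(i < m) P`_i *: D (x ^+ i * s).
  move=> /subnKC <-; rewrite big_split_ord /= [X in _ + X]big1 ?addr0 // => i _.
  by rewrite nth_default ?scale0r // leq_addr.
have PhiB (P Q : {poly S}) s : Phi (P - Q) s = Phi P s - Phi Q s.
  pose m := maxn (size P) (size Q).
  rewrite !(@PhiE _ m) ?leq_maxl ?leq_maxr //; last first.
    by rewrite (leq_trans (size_polyD _ _)) // size_polyN.
  by rewrite -sumrB; apply: eq_bigr => i _; rewrite coefB scalerBl.
have PhiC c (P : {poly S}) s : Phi (c%:P * P) s = c *: Phi P s.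
  rewrite (@PhiE _ (size P)) //; last first.
    by rewrite mul_polyC size_scale_leq.
  by rewrite scaler_sumr; apply: eq_bigr => i _; rewrite coefCM scalerA.
have PhiX (P : {poly S}) s : Phi ('X * P) s = Phi P (x * s).
  rewrite (@PhiE _ (size P).+1); last first.
    by have [->|P0] := eqVneq P 0; rewrite ?mulr0 ?size_poly0 // mulrC size_mulX.
  rewrite big_ord_recl coefXM scale0r add0r; apply: eq_bigr => i _.
  by rewrite coefXM /= exprSr mulrA.
have iterE m s : [[nseq m x, D]] s = Phi ((x%:P - 'X) ^+ m) s.
  elim: m s => [|m IH] s.
    by rewrite /Phi expr0 size_poly1 big_ord1 coef1 scale1r mul1r.
  by rewrite /= /bracket !IH exprS mulrBl PhiB PhiC PhiX.
have PhiXn m s : Phi ('X^m) s = D (x ^+ m * s).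
  elim: m s => [|m IH] s.
    by rewrite /Phi expr0 size_poly1 big_ord1 coef1 scale1r.
  by rewrite exprS PhiX IH exprSr mulrA.
apply/funext => s; rewrite iterE.
(* Frobenius is additive on S[X]; the factor ['X^0] brings both terms into the form that [PhiC] and
   [PhiXn] evaluate. *)
have -> : (x%:P - 'X) ^+ p = (x ^+ p)%:P * 'X^0 - 'X^p :> {poly S}.
  rewrite expr0 mulr1 rmorphXn /=.
  by rewrite -!(pFrobenius_autE pP) pFrobenius_autB_comm //; apply: mulrC.
by rewrite PhiB PhiC !PhiXn expr0 mul1r.
Qed.

End Brackets.

(** Up to order, [s] is a concatenation of constant blocks, one per distinct entry. *)
Lemma size_le_undup (T : eqType) (m : nat) (s : seq T) :
  (forall i, i \in s -> (count_mem i s <= m)%N) ->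
  (size s <= m * size (undup s))%N.
Proof.
move=> cs; rewrite -(perm_size (perm_count_undup s)) size_flatten /shape -map_comp.
rewrite (eq_map (g := fun i => count_mem i s)); last first.
  by move=> i /=; rewrite size_nseq.
have: {subset undup s <= s} by move=> i; rewrite mem_undup.
elim: (undup s) => //= i r IH sub; rewrite mulnS leq_add ?cs ?sub ?mem_head //.
by apply: IH => k kr; rewrite sub // in_cons kr orbT.
Qed.

(** * Brackets of maps extended along a p-basis *)

Section ReducedMonomials.
Variables (p n : nat) (R S : comNzRingType) (f : {rmorphism R -> S}).
Variables (x : n.-tuple S) (M : lmodType S).
Hypotheses (pS : p \in [pchar S]) (xP : p_basis f p x).
Implicit Types (F D : S -> M) (g : R -> restr_scalars f M).
Implicit Types (B : {set 'I_n}) (a : {ffun 'I_n -> 'I_p}).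

Local Notation X := (fun i => tnth x i).

Definition wmon B a : S :=
  \prod_(i < n) (if i \in B then (a i == p.-1 :> nat)%:R else tnth x i ^+ a i).

(* Shape of the bracket by all the x_i (i in B) of the extension of a map;
   for B = set0 it says that F is the extension of g. *)
Definition mon_shape B F g :=
  forall l a, F (f l * rmon x a) = wmon B a *: (g l : M).

Lemma mon_shape_bracket_base c B F g :
  mon_shape B F g -> mon_shape B (bracket (f c) F) (bracket c g).
Proof.
move=> Fg l a; rewrite /bracket mulrA -rmorphM !Fg.
(* Scaling by [c] in [restr_scalars f M] is by definition scaling by [f c] in [M]. *)
rewrite [X in _ = _ *: X](_ : _ = f c *: (g l : M) - g (c * l)) //.
by rewrite scalerBr !scalerA mulrC.
Qed.

(** Multiplying x^a by x_j raises a_j by one, and the two terms of the bracket cancel, unless a_j =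
    p - 1. Then a_j wraps to 0 and the coefficient gains [y], so the bracket by [y] appears. As
    [j \notin B], the weight still carries x_j^(a_j). *)
Lemma mon_shape_bracket_gen y j B F g :
    f y = tnth x j ^+ p -> j \notin B ->
  mon_shape B F g -> mon_shape (j |: B) (bracket (tnth x j) F) (bracket y g).
Proof.
move=> fy jB Fg l a; rewrite /bracket.
have p_gt0 : (0 < p)%N by rewrite prime_gt0 // (pcharf_prime pS).
pose off B a := \prod_(i < n | i != j)
  (if i \in B then (a i == p.-1 :> nat)%:R else tnth x i ^+ a i) : S.
pose upd c : {ffun 'I_n -> 'I_p} := [ffun i => if i == j then c else a i].
have offU c B' : off B' (upd c) = off B' a.
  by apply: eq_bigr => i /negPf ij; rewrite ffunE ij.
have off1 : off (j |: B) a = off B a.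
  by apply: eq_bigr => i /negPf ij; rewrite in_setU1 ij.
have rmonE b : rmon x b = tnth x j ^+ b j * off set0 b.
  rewrite /rmon (bigD1 j) //=; congr (_ * _).
  by apply: eq_bigr => i _; rewrite in_set0.
have wB b : wmon B b = tnth x j ^+ b j * off B b.
  by rewrite /wmon (bigD1 j) //= (negPf jB).
have wjB : wmon (j |: B) a = (a j == p.-1 :> nat)%:R * off B a.
  by rewrite /wmon (bigD1 j) //= setU11 -/(off _ _) off1.
have [aj|aj] := eqVneq (a j : nat) p.-1.
  have -> : tnth x j * (f l * rmon x a)
      = f (y * l) * rmon x (upd (Ordinal p_gt0)).
    rewrite !rmonE offU ffunE eqxx expr0 mul1r aj rmorphM fy mulrCA mulrA.
    rewrite -[in RHS](prednK p_gt0) exprS !mulrA; congr (_ * _).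
    by rewrite -!mulrA mulrC mulrA.
  rewrite !Fg !wB wjB offU ffunE eqxx expr0 mul1r aj eqxx mul1r.
  rewrite scalerA mulrA -exprS (prednK p_gt0) -fy.
  rewrite [X in _ = _ *: X](_ : _ = f y *: (g l : M) - g (y * l)) //.
  by rewrite scalerBr scalerA mulrC.
have aj1 : ((a j).+1 < p)%N.
  by rewrite -ltn_predRL ltn_neqAle aj -ltnS (prednK p_gt0) ltn_ord.
have -> : tnth x j * (f l * rmon x a) = f l * rmon x (upd (Ordinal aj1)).
  by rewrite !rmonE offU ffunE eqxx mulrCA exprS !mulrA.
rewrite !Fg !wB wjB offU ffunE eqxx exprS (negPf aj) mul0r scale0r.
by rewrite scalerA mulrA subrr.
Qed.

Lemma mon_shape_eq0 B F g : {morph F : s t / s + t} ->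
  mon_shape B F g -> (forall l, g l = 0) -> forall s, F s = 0.
Proof.
move=> FD Fg g0 s; case: xP => _ _ [/(_ s) [c ->] _].
have F0 : F 0 = 0 by apply: (addrI (F 0)); rewrite -FD !addr0.
elim/big_ind: _ => [|u v Fu Fv|a _] //; first by rewrite FD Fu Fv addr0.
by rewrite [F _]Fg g0 scaler0.
Qed.

(** [foldr] applies the last entries first, so the last K of them already give zero. *)
Lemma brackets_killed K g (ls : seq R) :
    (forall ls, size ls = K -> forall l, foldr (@bracket _ _) g ls l = 0) ->
  (K <= size ls)%N -> forall l, foldr (@bracket _ _) g ls l = 0.
Proof.
move=> g0 Kls; rewrite -(cat_take_drop (size ls - K) ls) foldr_cat.
by apply/brackets_eq0/g0; rewrite size_drop subKn.
Qed.

Lemma mon_shape_brackets_uniq (y : 'I_n -> R) (js : seq 'I_n) F g :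
    (forall i, f (y i) = tnth x i ^+ p) -> uniq js -> mon_shape set0 F g ->
  mon_shape [set i in js] (foldr (@bracket _ _) F (map X js))
    (foldr (@bracket _ _) g (map y js)).
Proof.
move=> fy + Fg; elim: js => [_|j js IH] /=.
  by rewrite (_ : [set i in [::]] = set0) //; apply/setP => i; rewrite !inE.
case/andP => jjs ujs; rewrite set_cons.
by apply: mon_shape_bracket_gen; rewrite ?inE //; apply: IH.
Qed.

(* Either some x_i is repeated more than p times, and p of its brackets amount
   to the bracket by x_i ^ p in R, or there are at least K distinct x_i, each
   of which contributes a bracket of g by x_i ^ p. *)
Lemma mon_shape_brackets_eq0 K F g (js : seq 'I_n) :
    {morph F : s t / s + t} -> mon_shape set0 F g ->
    (forall ls, size ls = K -> forall l, foldr (@bracket _ _) g ls l = 0) ->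
    (p * K < size js + p)%N ->
  forall s, foldr (@bracket _ _) F (map X js) s = 0.
Proof.
have [y fy] : exists y : 'I_n -> R, forall i, f (y i) = tnth x i ^+ p.
  case: xP => _ xp _.
  have [y fy] := choice (fun i => xp (tnth x i)).
  by exists y => i; rewrite fy.
elim: K F g js => [|K IH] F g js FD Fg g0 pK.
  by apply/brackets_eq0/(mon_shape_eq0 FD Fg) => l; apply: (g0 [::]).
have [/hasP[i _ pi]|] := boolP (has (fun i => p < count_mem i js)%N js).
  (* [r] is [js] with p copies of [i] removed, up to order. *)
  pose r := nseq (count_mem i js - p) i ++ filter (predC1 i) js.
  have pr : perm_eq js (r ++ nseq p i).
    rewrite perm_sym perm_catC catA -nseqD subnKC; last exact: ltnW.
    have -> : nseq (count_mem i js) i = filter (pred1 i) js.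
      by rewrite -size_filter; apply/esym/all_pred1P/filter_all.
    by rewrite perm_filterC.
  rewrite (brackets_perm _ (perm_map _ pr)) map_cat foldr_cat map_nseq.
  rewrite brackets_pchar // -fy; apply: (IH _ (bracket (y i) g)).
  - exact: bracket_additive.
  - exact: mon_shape_bracket_base.
  - by move=> ls sls l; rewrite -foldr_rcons g0 // size_rcons sls.
  - by move: pK; rewrite (perm_size pr) size_cat size_nseq mulnS addnC ltn_add2r.
move/hasPn => cle.
have [r pr] := perm_to_subseq (undup_subseq js).
(* The distinct indices are moved to the end, so that their brackets are applied first. *)
rewrite (brackets_perm _ (perm_map _ pr))
  -(brackets_perm _ (perm_map X (permEl (perm_catC r _)))).
rewrite map_cat foldr_cat; apply/brackets_eq0.
apply: (mon_shape_eq0 _ (mon_shape_brackets_uniq fy (undup_uniq _) Fg)).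
  exact: brackets_additive.
apply: brackets_killed g0 _; rewrite size_map.
(* No index occurs more than p times, so [size js <= p * size (undup js)]; with [pK] this gives at
   least [K.+1] distinct indices. *)
rewrite -ltnS -(ltn_pmul2l (prime_gt0 (pcharf_prime pS))).
rewrite (leq_trans pK) // mulnS addnC leq_add2l size_le_undup // => i ijs.
by rewrite leqNgt cle.
Qed.

(* An element f l counts for p of the x_i. *)
Definition vanishing (N : nat) D := {morph D : s t / s + t} /\
  forall (js : seq 'I_n) (ls : seq R), (N <= size js + p * size ls)%N ->
    forall s, foldr (@bracket _ _) D (map X js ++ map f ls) s = 0.

(* The c with this property form a subring containing the image of f and the
   x_i, hence all of S. *)
Lemma vanishing_bracket c N D : vanishing N.+1 D -> vanishing N (bracket c D).
Proof.
move=> DN; have [DD D0] := DN; split; first exact: bracket_additive.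
have p_gt0 : (0 < p)%N by rewrite prime_gt0 // (pcharf_prime pS).
move=> js ls Njl.
pose good c := forall s,
  foldr (@bracket _ _) (bracket c D) (map X js ++ map f ls) s = 0.
have good_f l : good (f l).
  move=> s; rewrite brackets_bracket.
  have /brackets_perm-> : perm_eq (map X js ++ map f ls) (map f ls ++ map X js).
    by rewrite perm_catC.
  have e : perm_eq (f l :: map f ls ++ map X js) (map X js ++ map f (l :: ls)).
    by rewrite perm_sym perm_catC.
  rewrite -[bracket _ _]/(foldr (@bracket _ _) D (f l :: _ ++ _)).
  rewrite (brackets_perm _ e) D0 //= mulnS addnCA -add1n.
  exact: leq_add.
have good_x i : good (tnth x i).
  by move=> s; rewrite brackets_bracket; apply: (D0 (i :: js)).
have goodM u v : good u -> good v -> good (u * v).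
  move=> gu gv s; rewrite bracketM brackets_add brackets_scale.
  by rewrite brackets_mul gu gv scaler0 addr0.
have goodD u v : good u -> good v -> good (u + v).
  by move=> gu gv s; rewrite bracketD // brackets_add gu gv addr0.
have good0 : good 0 by have := good_f 0; rewrite rmorph0.
have good1 : good 1 by have := good_f 1; rewrite rmorph1.
(* Expand [c] in the reduced monomials, with coefficients in the image of [f]. *)
case: xP => _ _ [/(_ c) [e ->] _].
elim/big_ind: _ => [||a _]; [exact: good0|exact: goodD|].
apply: (goodM _ _ (good_f _)).
apply: big_ind => [||i _]; [exact: good1|exact: goodM|].
by elim: (a i : nat) => // k IH; rewrite exprS; apply: (goodM _ _ (good_x i)).
Qed.

Lemma vanishing_brackets_eq0 (cs : seq S) D :
  vanishing (size cs) D -> forall s, foldr (@bracket _ _) D cs s = 0.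
Proof.
(* The summand 0 is generalized to N for the induction: each bracket lowers the bound by one, and
   [vanishing 0] with empty lists says that the map is zero. *)
rewrite -[size cs]addn0 => Dcs.
suff [_ /(_ [::] [::] isT)//] : vanishing 0 (foldr (@bracket _ _) D cs).
elim: cs 0%N Dcs => //= c cs IH N Dcs.
by apply/vanishing_bracket/IH; rewrite addnS.
Qed.

(** Brackets by [map f ls] pass to [g], leaving [k.+1 - size ls] brackets to kill it. The truncated
    difference is 0 once [size ls] exceeds [k], hence the final case split. *)
Lemma mon_shape_vanishing k F g :
    {morph F : s t / s + t} -> mon_shape set0 F g ->
    (forall ls, size ls = k.+1 -> forall l, foldr (@bracket _ _) g ls l = 0) ->
  vanishing (p * k).+1 F.
Proof.
move=> FD Fg g0; split=> // js ls kjl; rewrite foldr_cat.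
have shape_ls : mon_shape set0 (foldr (@bracket _ _) F (map f ls))
    (foldr (@bracket _ _) g ls).
  by elim: {kjl} ls => //= l ls; apply: mon_shape_bracket_base.
have FlsD := brackets_additive (map f ls) FD.
apply: (mon_shape_brackets_eq0 (K := k.+1 - size ls) FlsD shape_ls).
  move=> ls' sls' l; rewrite -foldr_cat; apply: (brackets_killed g0).
  by rewrite size_cat sls' addnC -leq_subLR.
have [kl|lk] := leqP k.+1 (size ls).
  have /eqP -> : (k.+1 - size ls == 0)%N by rewrite subn_eq0.
  by rewrite muln0 addn_gt0 (prime_gt0 (pcharf_prime pS)) orbT.
rewrite mulnBr mulnS -(ltn_add2r (p * size ls)) subnK; last first.
  by rewrite -mulnS leq_mul2l (ltnW lk) orbT.
by rewrite addnAC addnC ltn_add2r.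
Qed.

Lemma p_basis_coord :
  exists co : S -> {ffun 'I_n -> 'I_p} -> R,
    (forall v, \sum_a f (co v a) * rmon x a = v) /\
    (forall c a, co (\sum_a f (c a) * rmon x a) a = c a).
Proof.
case: xP => _ _ [gen free].
have [co coE] := choice gen; exists co; split=> [v|c a]; first exact/esym/coE.
apply/eqP; rewrite -subr_eq0; apply/eqP; set v := \sum_a _.
apply: (free (fun a => co v a - c a)).
under eq_bigr do rewrite scalerBl.
by rewrite sumrB -coE subrr.
Qed.

Lemma rmon0 a : (forall i, a i = 0 :> nat) -> rmon x a = 1.
Proof. by move=> a0; rewrite /rmon big1 // => i _; rewrite a0. Qed.

End ReducedMonomials.

(** * The extension map, its section property and the bound on orders *)

Theorem proposition4p23 (p : nat) (A : comNzRingType) (C : comAlgType A)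
    (n : nat) (x : n.-tuple C) (M : lmodType C)
    (charA : p \in [pchar A])
    (injA : injective (in_alg C))
    (expA : finite_exponent (in_alg C) p)
    (xP : p_basis (val : {rmorphism frob_alg p C -> C}) p x) :
  exists ext : {linear linHom (frob_alg p C) M -> linHom C M},
    [/\ forall (d : linHom (frob_alg p C) M) (D : C -> M),
          (forall lam : {ffun 'I_n -> 'I_p} -> frob_alg p C,
             D (\sum_a val (lam a) * rmon x a) = \sum_a rmon x a *: d (lam a))
          <-> D =1 ext d,
        forall d : linHom (frob_alg p C) M, linHom_res p (ext d) = d
      & forall (k : nat) (d : linHom (frob_alg p C) M),
          is_diff k
            (d : frob_alg p C ->
                 restr_scalars (val : {rmorphism frob_alg p C -> C}) M) ->
          is_diff (p * k) (ext d : C -> M)].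
Proof.
have pC : p \in [pchar C] by rewrite (rmorph_pchar (in_alg C) charA).
have p_gt0 : (0 < p)%N by rewrite prime_gt0 // (pcharf_prime pC).
have [co [co_sum coK]] := p_basis_coord xP.
(* The chosen coordinates are A-linear because coordinates in a basis are unique. *)
have coP (b : A) u v a : co (b *: u + v) a = b *: co u a + co v a.
  rewrite -{1}(co_sum u) -{1}(co_sum v) scaler_sumr -big_split /=.
  rewrite -[RHS](coK (fun a => b *: co u a + co v a)); congr (co _ a).
  by apply: eq_bigr => i _; rewrite rmorphD mulrDl scalerAl.
pose e (d : linHom (frob_alg p C) M) (v : C) : M :=
  \sum_a rmon x a *: d (co v a).
have eP d : linear_for (in_alg C \; *:%R) (e d).
  move=> b u v; rewrite /e /= scaler_sumr -big_split; apply: eq_bigr => a _ /=.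
  by rewrite coP linearP /= scalerDr !scalerA mulrC.
pose ext0 d : linHom C M := linHom_of (eP d).
have extP : linear ext0.
  move=> c u v; apply: linHom_eqP => s /=; rewrite /e scaler_sumr -big_split.
  by apply: eq_bigr => a _ /=; rewrite scalerDr !scalerA mulrC.
pose ext : {linear linHom (frob_alg p C) M -> linHom C M} :=
  HB.pack ext0 (GRing.isLinear.Build _ _ _ _ ext0 extP).
have extE d s : ext d s = e d s by [].
have ext_sum d (lam : {ffun 'I_n -> 'I_p} -> frob_alg p C) :
    ext d (\sum_a val (lam a) * rmon x a) = \sum_a rmon x a *: d (lam a).
  by rewrite extE; apply: eq_bigr => a _; rewrite coK.
have ext_mon d (l : frob_alg p C) (a : {ffun 'I_n -> 'I_p}) :
      ext d (val l * rmon x a) = rmon x a *: d l.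
  have -> : val l * rmon x a = \sum_b val (if b == a then l else 0) * rmon x b.
    rewrite (bigD1 a) //= eqxx big1 ?addr0 // => b /negPf->.
    by rewrite /= mul0r.
  rewrite ext_sum (bigD1 a) //= eqxx big1 ?addr0 // => b /negPf->.
  by rewrite /= linear0 scaler0.
exists ext; split.
- move=> d D; split=> [DE s|DE lam]; last by rewrite DE ext_sum.
  by rewrite -(co_sum s) DE ext_sum.
- move=> d; apply: linHom_eqP => l.
  (* The zero exponent gives the monomial 1, which embeds C^[1] in C. *)
  pose a0 : {ffun 'I_n -> 'I_p} := [ffun=> Ordinal p_gt0].
  have m0 : rmon x a0 = 1 by apply: rmon0 => i; rewrite ffunE.
  by have := ext_mon d l a0; rewrite m0 mulr1 scale1r.
- move=> k d [_ dk]; split; first exact: eP.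
  (* Order at most p k means p k + 1 brackets, exactly the bound in [mon_shape_vanishing]. *)
  move=> xs; apply: (vanishing_brackets_eq0 pC xP); rewrite size_tuple.
  apply: (mon_shape_vanishing pC xP (g := d)).
  + exact: linearD.
  + move=> l a; rewrite [LHS]ext_mon; congr (_ *: _).
    by apply: eq_bigr => i _; rewrite in_set0.
  + by move=> ls sls; apply: (dk (Tuple (introT eqP sls))).
Qed.
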